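(* For every $p\in(1,\infty)$ there exist weights $w,v$ on $\mathbb{R}$ satisfying $$\sup_{\lambda\in\mathbb{C}_+}\Big(\int_{\mathbb{R}}\frac{(\operatorname{Im}\lambda)^{p-1}}{|x-\lambda|^{p}}w(x)\,dx\Big)\Big(\int_{\mathbb{R}}\frac{(\operatorname{Im}\lambda)^{p'-1}}{|x-\lambda|^{p'}}v(x)^{-1/(p-1)}\,dx\Big)^{p-1}<\infty,$$ such that the Hilbert transform $H$ is not a bounded operator acting from $L^p(v)$ to $L^p(w)$. In particular, there exists $f\in L^p(v)$ such that $\|Hf\|_{L^p(w)}=\infty$.
   Context: A weight on $\mathbb{R}$ is a locally integrable function that is positive a.e. The norm in $L^p(w)$ is $\|f\|_{L^p(w)}^p=\int_{\mathbb{R}}|f(x)|^pw(x)\,dx$. Here $p'$ is the Hölder conjugate of $p$ ($1/p+1/p'=1$), $\mathbb{C}_+$ is the open upper half-plane, and $H$ is the Hilbert transform, $Hf(x)=\mathrm{p.v.}\int_{\mathbb{R}}\frac{f(y)}{x-y}\,dy$. *)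

(* Defs.v *)
From HB Require Import structures.
From mathcomp Require Import all_boot all_order all_algebra.
From mathcomp Require Import complex.
From mathcomp Require Import all_classical all_reals all_analysis.

Set Implicit Arguments.
Unset Strict Implicit.
Unset Printing Implicit Defensive.

Import Order.TTheory GRing.Theory Num.Theory.
Import numFieldNormedType.Exports.

Local Open Scope classical_set_scope.
Local Open Scope ring_scope.

Section defs.
Context {R : realType}.
Local Notation mu := (@lebesgue_measure R).

(* [locally_integrable] includes measurability. *)
Definition weight (w : R -> R) : Prop :=
  locally_integrable setT w /\ {ae mu, forall x, 0 < w x}.

Definition weighted_norm (p : R) (w f : R -> R) : \bar R :=
  ((\int[mu]_x (`|f x| `^ p * w x)%:E) `^ p^-1)%E.

Definition in_weighted_Lp (p : R) (w f : R -> R) : Prop :=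
  measurable_fun setT f /\ (weighted_norm p w f < +oo)%E.

Definition upper_half_plane : set R[i] := [set z | 0 < complex.Im z].

(* The kernel (Im z)^(r - 1) / |x - z|^r, used with r = p and r = p'. *)
Definition poisson_like (r : R) (z : R[i]) (x : R) : R :=
  complex.Im z `^ (r - 1) / Normc.normc (x%:C%C - z) `^ r.

(* The two integrals may a priori be infinite, so the product is formed in the
   extended reals. For weights both factors are positive, hence the convention
   0 * +oo = 0 plays no role. *)
Definition joint_Ap_product (p q : R) (w v : R -> R) (z : R[i]) : \bar R :=
  ((\int[mu]_x (poisson_like p z x * w x)%:E) *
   (\int[mu]_x (poisson_like q z x * v x `^ (- (p - 1)^-1))%:E) `^ (p - 1))%E.

Definition away (x eps : R) : set R := [set y | eps < `|x - y|].

Definition hilbert_trunc (f : R -> R) (x eps : R) : R :=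
  (\int[mu]_(y in away x eps) (f y / (x - y)))%R.

(* The principal value at x is meaningful: the truncated integrals converge
   absolutely and have a finite limit as the truncation is removed. *)
Definition hilbert_defined (f : R -> R) (x : R) : Prop :=
  (forall eps : R, 0 < eps ->
     mu.-integrable (away x eps) (fun y => (f y / (x - y))%:E)) /\
  cvg (hilbert_trunc f x eps @[eps --> 0^'+]).

(* A junk value where [hilbert_defined f x] fails. *)
Definition hilbert (f : R -> R) (x : R) : R :=
  lim (hilbert_trunc f x eps @[eps --> 0^'+]).

Definition hilbert_ae_defined (f : R -> R) : Prop :=
  {ae mu, forall x, hilbert_defined f x}.

(* The norm inequality is only required of those f whose Hilbert transform
   exists a.e., so that unboundedness can never come from junk values or from
   the mere failure of Hf to be defined. *)
Definition hilbert_bounded (p : R) (v w : R -> R) : Prop :=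
  exists C : R, forall f : R -> R,
    in_weighted_Lp p v f -> hilbert_ae_defined f ->
    (weighted_norm p w (hilbert f) <= C%:E * weighted_norm p v f)%E.

End defs.

(* Main.v *)
Require Import Defs.
From mathcomp Require Import all_boot all_order all_algebra.
From mathcomp Require Import complex.
From mathcomp Require Import all_classical all_reals all_analysis.
From mathcomp Require Import measurable_realfun.
From mathcomp Require Import zify ring lra.
Import Order.TTheory GRing.Theory Num.Theory.
Import numFieldNormedType.Exports.
Local Open Scope classical_set_scope.
Local Open Scope ring_scope.

(* Let [E_k] be the [k]-th stage of the Cantor set of reals whose base-5 digits
   all lie in {1, 3}: it consists of [2 ^ k] intervals of length [5 ^ -k], and
   each stage stays well inside the previous one. Put [s = 5 / 2]. On
   [E_k \ E_(k+1)] the weight [w] is [s ^ (-k (p - 1))]; the density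
   [sigma = v ^ (-1 / (p - 1))] is [1 + f], where [f >= 0] lives on the part of
   [E_k \ E_(k+1)] with next digit 0 and gives mass [2 ^ -k * M_k] to each
   interval of [E_k], with [M_k = (k + 1) ^ (-1 / p)]. At scale [5 ^ -k] near the
   Cantor set the averages of [sigma] and [w] are at most of order [s ^ k] and
   [s ^ (-k (p - 1))], so the joint [A_p] product is bounded. On the other hand
   [Hf] is decreasing across the central gap of each interval of [E_k], with a
   total drop of order [s ^ k * M_k]; so [|Hf|] is at least of this order on a
   fixed proportion of the gap. Summing over the gaps of all levels,
   [int |Hf| ^ p w >= c * sum M_k ^ p = c * sum 1 / (k + 1) = oo], whereas
   [int f ^ p v <= int f <= 1]. *)

Set Implicit Arguments.
Unset Strict Implicit.
Unset Printing Implicit Defensive.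

(** * Base-5 cells and the stages of the Cantor set *)

Fixpoint good (k : nat) (m : int) : bool :=
  if k is k'.+1 then ((m %% 5)%Z \in [:: 1; 3]) && good k' (m %/ 5)%Z
  else m == 0.

Section cells.
Context {R : realType}.
Local Notation mu := (@lebesgue_measure R).
Implicit Types (x y : R) (m : int) (n k i : nat).

(** One integer carries all base-5 digits of [x] up to place [n], so that the geometry of cells
    becomes integer arithmetic. The intervals of [E_k] are the cells whose index satisfies
    [good k]. *)
Definition adic n x : int := Num.floor (5 ^+ n * x).
Definition cyl n (P : pred int) : set R := [set x | P (adic n x)].
Definition cell n m : set R := cyl n (pred1 m).
Definition cantor_level k : set R := cyl k (good k).

Lemma adicS n x : adic n x = (adic n.+1 x %/ 5)%Z.
Proof.
rewrite /adic; have := floor_itv (5 ^+ n.+1 * x); set m := Num.floor _ => mx.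
apply: floor_def.
have h1 : ((m %/ 5)%Z * 5 <= m) by lia.
have h2 : (m + 1 <= ((m %/ 5)%Z + 1) * 5) by lia.
move: h1 h2; rewrite -(ler_int R) -(ler_int R (m + 1)) !intrM => h1 h2.
case/andP: mx; rewrite exprS -mulrA => m1 m2.
apply/andP; split; lra.
Qed.

Lemma cantor_levelS k x : cantor_level k.+1 x -> cantor_level k x.
Proof. by rewrite /cantor_level /cyl/= => /andP[_]; rewrite -adicS. Qed.

Lemma cantor_level_le k n x : (k <= n)%N -> cantor_level n x -> cantor_level k x.
Proof.
move=> /subnK <-; elim: (n - k)%N => // d IH.
by rewrite addSn => /cantor_levelS.
Qed.

Lemma adic_near n x y : 5 ^+ n * `|x - y| <= 1 ->
  adic n x = adic n y - 1 \/ adic n x = adic n y \/ adic n x = adic n y + 1.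
Proof.
move=> xy.
have h : `|5 ^+ n * x - 5 ^+ n * y| <= 1.
  by rewrite -mulrBr normrM ger0_norm ?exprn_ge0.
move: h; rewrite ler_norml => /andP[h1 h2].
have /andP[a1 a2] := floor_itv (5 ^+ n * x).
have /andP[b1 b2] := floor_itv (5 ^+ n * y).
rewrite /adic; move: a1 a2 b1 b2.
set a := Num.floor (_ * x); set b := Num.floor (_ * y).
rewrite !intrD => a1 a2 b1 b2.
have c1 : a < b + 2 by rewrite -(ltr_int R) intrD; lra.
have c2 : b < a + 2 by rewrite -(ltr_int R) intrD; lra.
lia.
Qed.

(** The digits 1 and 3 have both neighbours among the digits 0 to 4, so a shift by one unit in the
    last place causes no carry. *)
Lemma cantor_level_near i x y : 5 ^+ i.+1 * `|x - y| <= 1 ->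
  cantor_level i.+1 y -> cantor_level i x.
Proof.
move=> /adic_near h; rewrite /cantor_level /cyl/= -[(adic i.+1 _ %/ 5)%Z]adicS.
move=> /andP[d yi]; suff -> : adic i x = adic i y by [].
rewrite (adicS i x) (adicS i y); move: d; rewrite !inE; lia.
Qed.

Lemma cellE n m : cell n m = `[m%:~R / 5 ^+ n, (m + 1)%:~R / 5 ^+ n[%classic.
Proof.
have p5 : (0 : R) < 5 ^+ n by rewrite exprn_gt0.
apply/seteqP; split => x /=; rewrite /cell /cyl/= /adic floor_eq in_itv/=.
  by rewrite ler_pdivrMr// ltr_pdivlMr// ![x * _]mulrC.
by rewrite ler_pdivrMr// ltr_pdivlMr// ![x * _]mulrC.
Qed.

Lemma measurable_cell n m : measurable (cell n m).
Proof. by rewrite cellE. Qed.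

Lemma measurable_cyl n (P : pred int) : measurable (cyl n P).
Proof.
rewrite (_ : cyl n P = \bigcup_(m : int) (if P m then cell n m else set0)).
  apply: countable_bigcupT_measurable; first exact: countableP.
  by move=> m; case: ifP => _ //; exact: measurable_cell.
apply/seteqP; split => x.
  by rewrite /cyl/= => Px; exists (adic n x) => //; rewrite Px /cell /cyl/=.
by case=> m _; case: ifPn => // Pm /eqP xm; rewrite /cyl/= xm.
Qed.

Lemma lebesgue_measure_cell n m : mu (cell n m) = (5 ^- n)%:E.
Proof.
rewrite cellE lebesgue_measure_itv/= lte_fin ltr_pM2r ?invr_gt0 ?exprn_gt0//.
by rewrite ltr_int ltzD1 lexx -EFinB -mulrBl intrD addrAC subrr add0r mul1r.
Qed.

Lemma cell_split (S : set R) i m : S `<=` cantor_level i.+1 ->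
  cell i m `&` S =
  (cell i.+1 (m * 5 + 1) `&` S) `|` (cell i.+1 (m * 5 + 3) `&` S).
Proof.
move=> Si; apply/seteqP; split => x; rewrite /cell /cyl/=.
  rewrite (adicS i x) => -[xm Sx]; have /andP[d _] := Si _ Sx.
  move: d xm; rewrite !inE.
  have [->|n1] := eqVneq (adic i.+1 x) (m * 5 + 1)%R; first by left.
  by right; split => //; lia.
by rewrite (adicS i x); move=> [[/eqP ->]|[/eqP ->]] ?; (split => //; lia).
Qed.

Lemma good_child i m d : d \in [:: 1; 3] -> good i m -> good i.+1 (m * 5 + d).
Proof.
move=> d13 g /=; move: d13; rewrite !inE => d13; apply/andP; split; first lia.
by rewrite (_ : ((m * 5 + d) %/ 5)%Z = m)//; lia.
Qed.

(** Each good cell has exactly two good children, and [S] meets no other child; hence the mass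
    doubles with each level climbed from [k] up to [i]. *)
Lemma measure_cell_self_similar (S : set R) k (c : R) : measurable S ->
  S `<=` cantor_level k ->
  (forall m, good k m -> mu (cell k m `&` S) = c%:E) ->
  forall i m, (i <= k)%N -> good i m ->
  mu (cell i m `&` S) = (2 ^+ (k - i) * c)%:E.
Proof.
move=> mS Sk Hc i m ik; move: (erefl (k - i)%N).
move: {2}(k - i)%N => d; elim: d i m ik => [|d IH] i m ik kid gm.
  have -> : i = k by lia.
  by rewrite Hc; [rewrite subnn mul1r|have -> : k = i by lia].
have ik1 : (i < k)%N by lia.
rewrite cell_split; last by move=> x /Sk; exact: cantor_level_le.
have mI j a : measurable (cell j a `&` S).
  by apply: measurableI => //; exact: measurable_cell.
transitivity (mu (cell i.+1 (m * 5 + 1) `&` S) +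
              mu (cell i.+1 (m * 5 + 3) `&` S))%E.
  apply: measureU; [exact: mI|exact: mI|apply/seteqP; split => x //=].
  by rewrite /cell /cyl/= => -[[/eqP-> _] [/eqP h _]]; lia.
rewrite !IH ?good_child// ?inE//; [|lia..].
by rewrite (_ : (k - i = (k - i.+1).+1)%N) ?[in RHS]exprS -?EFinD; [congr EFin; ring|lia].
Qed.
End cells.

(** * Functions constant on each of countably many disjoint sets *)

Section step_functions.
Context {d} {T : measurableType d} {R : realType}.
Implicit Types (S : nat -> set T) (a : nat -> R).

(** The index is picked by choice, so the value is canonical only when the [S k] are disjoint. *)
Definition step S a (x : T) : R :=
  if pselect (exists k, S k x) is left Sx then a (projT1 (cid Sx)) else 0.

Lemma stepE S a k x : trivIset setT S -> S k x -> step S a x = a k.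
Proof.
move=> tS Sx; rewrite /step; case: pselect => [h|]; last by case; exists k.
congr a; case: cid => i /= Si.
by apply: (tS i k) => //; exists x.
Qed.

Lemma step_out S a x : (forall k, ~ S k x) -> step S a x = 0.
Proof. by move=> h; rewrite /step; case: pselect => // -[k Sx]; have := h k Sx. Qed.

Variant step_spec S a x : R -> Prop :=
| StepIn k of S k x : step_spec S a x (a k)
| StepOut of (forall k, ~ S k x) : step_spec S a x 0.

Lemma stepP S a x : step_spec S a x (step S a x).
Proof.
rewrite /step; case: pselect => [h|h].
  by case: cid => k Sx; exact: StepIn.
by apply: StepOut => k Sx; apply: h; exists k.
Qed.

Lemma step_ge0 S a x : (forall k, 0 <= a k) -> 0 <= step S a x.
Proof. by move=> a0; case: stepP. Qed.

Lemma measurable_step S a : (forall k, measurable (S k)) -> trivIset setT S ->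
  measurable_fun setT (step S a).
Proof.
move=> mS tS _ Y mY; rewrite setTI.
rewrite (_ : _ @^-1` Y = (\bigcup_(k in [set k | Y (a k)]) S k) `|`
  ((if asbool (Y 0) then setT else set0) `&` ~` (\bigcup_k S k))).
  apply: measurableU; first exact: bigcup_measurable.
  apply: measurableI; first by case: ifP.
  by apply: measurableC; exact: bigcup_measurable.
apply/seteqP; split => x /=.
  case: stepP => [k Sx Yx|So Yx]; first by left; exists k.
  by right; rewrite asboolT//; split => // -[k _]; exact: So.
case=> [[k /= Yk Sx]|[]]; first by rewrite (stepE _ tS Sx).
case: asboolP => // Y0 _ So.
by rewrite step_out// => k Sx; apply: So; exists k.
Qed.

Lemma integral_step (mu : {measure set T -> \bar R}) S a (D : set T) :
  (forall k, measurable (S k)) -> trivIset setT S -> (forall k, 0 <= a k) ->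
  measurable D ->
  (\int[mu]_(x in D) (step S a x)%:E =
   \sum_(k <oo) (a k)%:E * mu (D `&` S k))%E.
Proof.
move=> mS tS a0 mD.
have mst : measurable_fun setT (fun x => (step S a x)%:E).
  by apply/measurable_EFinP; exact: measurable_step.
(* The default value 0 allows the domain to shrink to the union of the [S k]. *)
transitivity (\int[mu]_(x in D `&` \bigcup_k S k) (step S a x)%:E)%E.
  rewrite integral_mkcondr; apply: eq_integral => x _; rewrite /patch.
  case: ifPn => // /negP; rewrite inE => So.
  by rewrite step_out// => k Sx; apply: So; exists k.
rewrite setI_bigcupr ge0_integral_bigcup//.
- apply: eq_eseriesr => k _.
  rewrite (eq_integral (cst (a k)%:E)).
    by rewrite integral_cst//; exact: measurableI.
  by move=> x; rewrite inE => -[_ Sx]; rewrite (stepE _ tS Sx).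
- by move=> k; exact: measurableI.
- exact: measurable_funTS.
- by move=> x _; rewrite lee_fin step_ge0.
- exact: trivIset_setIl.
Qed.

(* The integral of a nonnegative function is a supremum over simple functions
   below it, so no measurability is needed; this spares us the measurability of
   the Hilbert transform. *)
Lemma ge0_le_integralT (mu : {measure set T -> \bar R}) (f g : T -> \bar R) :
  (forall x, 0 <= f x)%E -> (forall x, f x <= g x)%E ->
  (\int[mu]_x f x <= \int[mu]_x g x)%E.
Proof.
move=> f0 fg; have g0 x : (0 <= g x)%E by exact: le_trans (f0 x) (fg x).
rewrite !ge0_integralTE//; apply: le_ereal_sup => _ [h hf <-].
by exists h => // x; exact: le_trans (hf x) (fg x).
Qed.

End step_functions.

Lemma nneseries_le (R : realType) (a : nat -> \bar R) (c : \bar R) :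
  (forall k, 0 <= a k)%E -> (forall n, \sum_(0 <= k < n) a k <= c)%E ->
  (\sum_(k <oo) a k <= c)%E.
Proof.
move=> a0 ac; apply: lime_le; first exact: is_cvg_nneseries.
by apply: nearW => n; exact: ac.
Qed.

(** * The gaps that carry the mass of the source *)

Section source_gaps.
Context {R : realType}.
Local Notation mu := (@lebesgue_measure R).
Implicit Types (x : R) (m : int) (k i : nat).

Definition source_gap k : set R :=
  cyl k.+1 (fun m => ((m %% 5)%Z == 0) && good k (m %/ 5)%Z).

Lemma source_gap_sub k : source_gap k `<=` cantor_level k.
Proof.
move=> x; rewrite /source_gap /cantor_level /cyl/= => /andP[_].
by rewrite -adicS.
Qed.

Lemma source_gapN k i x : (k < i)%N -> source_gap k x -> ~ cantor_level i x.
Proof.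
move=> ki; rewrite /source_gap /cyl/= => /andP[d _] /(cantor_level_le ki).
by rewrite /cantor_level /cyl/= => /andP[]; rewrite !inE; lia.
Qed.

Lemma trivIset_source_gap : trivIset setT source_gap.
Proof.
move=> i j _ _ [x [ix jx]]; have [ij|ji|//] := ltngtP i j.
  by case: (source_gapN ij ix); exact: source_gap_sub.
by case: (source_gapN ji jx); exact: source_gap_sub.
Qed.

Lemma measurable_source_gap k : measurable (source_gap k).
Proof. exact: measurable_cyl. Qed.

Lemma measure_cell_source_gap k m : good k m ->
  mu (cell k m `&` source_gap k) = (5 ^- k.+1)%:E.
Proof.
move=> km; rewrite (_ : _ `&` _ = cell k.+1 (m * 5)) ?lebesgue_measure_cell//.
apply/seteqP; split => x; rewrite /cell /source_gap /cyl/=.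
  by rewrite (adicS k x) => -[/eqP xm /andP[d _]]; lia.
rewrite (adicS k x) => /eqP ->; split; first lia.
by rewrite mulzK// km andbT; lia.
Qed.

End source_gaps.

(** * The source density and its mass on cells *)

Section weights.
Context {R : realType} (p : R) (p1 : 1 < p).
Local Notation mu := (@lebesgue_measure R).
Implicit Types (x y : R) (m : int) (n k i : nat).

Definition remaining_mass k : R := k.+1%:R `^ (- p^-1).
Definition gap_mass k : R := remaining_mass k - remaining_mass k.+1.
(** Each gap of level [k] has length [5 ^ -(k + 1)], so the chosen height gives it mass
    [2 ^ -k * gap_mass k]; the [gap_mass] telescope to [M_k]. *)
Definition source : R -> R :=
  step source_gap (fun k => 5 * (5 / 2) ^+ k * gap_mass k).

Lemma remaining_mass0 : remaining_mass 0 = 1.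
Proof. by rewrite /remaining_mass powR1. Qed.

Lemma remaining_mass_gt0 k : 0 < remaining_mass k.
Proof. by rewrite powR_gt0. Qed.

Lemma gap_mass_ge0 k : 0 <= gap_mass k.
Proof.
rewrite subr_ge0 /remaining_mass !powRN lef_pV2 ?posrE ?powR_gt0//.
by rewrite ge0_ler_powR ?nnegrE ?invr_ge0 ?ler_nat// ltW// (lt_trans _ p1).
Qed.

Lemma sum_gap_mass i n : (i <= n)%N ->
  \sum_(i <= k < n) gap_mass k = remaining_mass i - remaining_mass n.
Proof.
move=> ile; rewrite -opprB -(telescope_sumr _ ile) -sumrN.
by apply: eq_bigr => k _; rewrite opprB.
Qed.

(** A quantitative form of [M_n -> 0], which lets a finite partial sum give the lower bound on the
    mass of a cell. *)
Lemma remaining_mass_half i :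
  exists2 n, (i <= n)%N & remaining_mass n <= remaining_mass i / 2.
Proof.
have p0 : 0 < p by rewrite (lt_trans _ p1).
(* As [c >= 2 ^ p], multiplying the argument [i + 1] by [c] at least halves its power [-1 / p]. The
   predecessor in the witness undoes the shift in [remaining_mass]. *)
pose c := (Num.truncn (2 `^ p)).+1.
have c2 : 2 `^ p <= c%:R by rewrite ltW// truncnS_gt.
exists (c * i.+1).-1; first by rewrite /c; lia.
rewrite /remaining_mass prednK ?muln_gt0// natrM powRM// [leLHS]mulrC.
rewrite ler_pM2l ?powR_gt0// powRN lef_pV2 ?posrE ?powR_gt0//.
have -> : 2 = (2 `^ p) `^ p^-1 :> R by rewrite -powRrM mulfV ?gt_eqF// powRr1.
by rewrite ge0_ler_powR ?nnegrE ?invr_ge0 ?powR_ge0// ltW.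
Qed.

Lemma measurable_source : measurable_fun setT source.
Proof. exact: measurable_step measurable_source_gap trivIset_source_gap. Qed.

Lemma source_val_ge0 k : 0 <= 5 * (5 / 2) ^+ k * gap_mass k :> R.
Proof. by rewrite mulr_ge0 ?gap_mass_ge0// mulr_ge0// exprn_ge0. Qed.

Lemma source_ge0 x : 0 <= source x.
Proof. by apply: step_ge0 => k; exact: source_val_ge0. Qed.

Lemma gap_mass_le1 k : gap_mass k <= 1.
Proof.
rewrite /gap_mass lerBlDr (@le_trans _ _ 1)//; last first.
  by rewrite lerDl ltW// remaining_mass_gt0.
rewrite /remaining_mass powRN invf_le1 ?powR_gt0//.
by rewrite -[leLHS](powRr0 k.+1%:R) ler_powR ?ler1n// invr_ge0 ltW// (lt_trans _ p1).
Qed.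

(** Off [E_i] only gaps of level below [i] can contain [x], and [gap_mass] is at most 1. *)
Lemma source_le i x : ~ cantor_level i x -> source x <= 5 * (5 / 2) ^+ i.
Proof.
move=> xi; rewrite /source; case: stepP => [k kx|_]; last first.
  by rewrite mulr_ge0// exprn_ge0.
have ki : (k < i)%N.
  rewrite ltnNge; apply/negP => ik; apply: xi.
  exact: cantor_level_le ik (source_gap_sub kx).
rewrite (@le_trans _ _ (5 * (5 / 2) ^+ k))//.
  by rewrite ler_piMr ?gap_mass_le1// mulr_ge0// exprn_ge0.
by rewrite ler_pM2l// ler_weXn2l ?(ltnW ki)//; lra.
Qed.

(** For [i <= k] a good cell of level [i] contains [2 ^ (k - i)] gaps of level [k]; for [k < i] the
    gaps of level [k] lie off [E_i]. *)
Lemma measure_good_cell_source_gap i k m : good i m ->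
  ((5 * (5 / 2) ^+ k * gap_mass k)%:E * mu (cell i m `&` source_gap k) =
   (if (i <= k)%N then 2 ^- i * gap_mass k else 0%R)%:E)%E.
Proof.
move=> im; case: leqP => ik.
  rewrite (measure_cell_self_similar (measurable_source_gap k)
    (@source_gap_sub R k) (@measure_cell_source_gap R k))//.
  rewrite -EFinM; congr EFin.
  rewrite exprS expr_div_n (_ : 2 ^+ k = 2 ^+ i * 2 ^+ (k - i) :> R).
    by field; rewrite !expf_neq0.
  by rewrite -exprD subnKC.
rewrite (_ : _ `&` _ = set0) ?measure0 ?mule0//.
apply/seteqP; split => x //; rewrite /cell /cyl/= => -[/eqP xm].
by move=> /(source_gapN ik); apply; rewrite /cantor_level /cyl/= xm.
Qed.

(** By telescoping the exact mass is [2 ^ -i * M_i]. The lower bound loses a factor 2 by keeping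
    finitely many levels; the upper bound uses [M_0 = 1]. *)
Lemma integral_source_good i m : good i m ->
  ((2 ^- i * (remaining_mass i / 2))%:E <=
   \int[mu]_(x in cell i m) (source x)%:E <= (2 ^- i)%:E)%E.
Proof.
move=> im; rewrite /source integral_step; last 4 first.
- exact: measurable_source_gap.
- exact: trivIset_source_gap.
- exact: source_val_ge0.
- exact: measurable_cell.
rewrite (eq_eseriesr (fun k _ => measure_good_cell_source_gap k im)).
pose t k := if (i <= k)%N then 2 ^- i * gap_mass k else 0.
rewrite -/(t _).
have t0 k : 0 <= t k.
  by rewrite /t; case: ifP => // _; rewrite mulr_ge0 ?gap_mass_ge0// invr_ge0 exprn_ge0.
apply/andP; split; last first.
  apply: nneseries_le => [k|n]; first by rewrite lee_fin t0.
  rewrite sumEFin lee_fin (@le_trans _ _ (\sum_(0 <= k < n) 2 ^- i * gap_mass k))//.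
    apply: ler_sum => k _; rewrite /t; case: ifP => // _.
    by rewrite mulr_ge0 ?gap_mass_ge0// invr_ge0 exprn_ge0.
  rewrite -mulr_sumr sum_gap_mass// remaining_mass0 ler_piMr ?invr_ge0 ?exprn_ge0//.
  by rewrite gerBl ltW// remaining_mass_gt0.
have [n ile half] := remaining_mass_half i.
apply: le_trans (nneseries_lim_ge n _); last by move=> k _; rewrite lee_fin t0.
rewrite sumEFin lee_fin (big_cat_nat_idem _ _ ile) //=; last by rewrite addr0.
rewrite (@le_trans _ _ (\sum_(i <= k < n) t k))//; last first.
  by rewrite lerDr sumr_ge0// => k _; exact: t0.
rewrite (eq_big_nat _ _ (F2 := fun k => 2 ^- i * gap_mass k)); last first.
  by move=> k /andP[ik _]; rewrite /t ik.
rewrite -mulr_sumr sum_gap_mass// ler_pM2l ?invr_gt0 ?exprn_gt0//.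
by lra.
Qed.

(** A cell that is not good misses [E_i]; there the pointwise bound [source_le] times the length
    [5 ^ -i] gives [5 * 2 ^ -i]. *)
Lemma integral_source_cell i m :
  (\int[mu]_(x in cell i m) (source x)%:E <= (5 * 2 ^- i)%:E)%E.
Proof.
have [im|im] := boolP (good i m).
  have /andP[_ h] := integral_source_good im.
  rewrite (le_trans h)// lee_fin ler_peMl ?invr_ge0 ?exprn_ge0//; lra.
have h : (\int[mu]_(x in cell i m) (source x)%:E <=
    \int[mu]_(x in cell i m) (5 * (5 / 2) ^+ i)%:E)%E.
  apply: ge0_le_integral => //.
  - exact: measurable_cell.
  - by move=> x _; rewrite lee_fin source_ge0.
  - by apply/measurable_EFinP; exact: measurable_funTS measurable_source.
  - move=> x xm; rewrite lee_fin source_le// /cantor_level /cyl/=.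
    by move: xm; rewrite /cell /cyl/= => /eqP ->; exact/negP.
rewrite (le_trans h)// integral_cst; last exact: measurable_cell.
rewrite [X in (_ * X)%E](lebesgue_measure_cell i m) -EFinM lee_fin expr_div_n.
by rewrite le_eqVlt; apply/orP; left; apply/eqP; field; rewrite ?expf_neq0.
Qed.

Lemma source_out x : adic 0 x != 0 -> source x = 0.
Proof.
move=> x0; rewrite /source step_out// => k /source_gap_sub.
by move=> /(cantor_level_le (leq0n k)); rewrite /cantor_level /cyl/=; exact/negP.
Qed.

Lemma integral_source : (\int[mu]_x (source x)%:E <= 1)%E.
Proof.
rewrite (_ : integral _ _ _ = (\int[mu]_(x in cell 0 0) (source x)%:E)%E).
  by have /andP[_] := @integral_source_good 0 0 erefl; rewrite expr0 invr1.
rewrite [RHS]integral_mkcond; apply: eq_integral => x _.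
rewrite /patch; case: ifPn => //; rewrite notin_setE /cell /cyl/= => /negP x0.
by rewrite source_out.
Qed.

Lemma integrable_source : mu.-integrable setT (EFin \o source).
Proof.
apply/integrableP; split; first by apply/measurable_EFinP; exact: measurable_source.
apply: le_lt_trans (ltry 1); apply: le_trans integral_source.
by under eq_integral do rewrite /= ger0_norm ?source_ge0//.
Qed.

End weights.

Lemma powRX (R : realType) (x a : R) n : 0 <= x ->
  (x ^+ n) `^ a = (x `^ a) ^+ n.
Proof.
move=> x0; elim: n => [|n IH]; first by rewrite !expr0 powR1.
by rewrite !exprS powRM ?exprn_ge0// IH.
Qed.

(** * Integrals against the kernel [poisson_like] *)

Section kernel.
Context {R : realType}.
Local Notation mu := (@lebesgue_measure R).
Implicit Types (x y r : R) (z : R[i]).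

Definition cball (c r : R) : set R := `[c - r, c + r]%classic.

Lemma cballP c r x : cball c r x <-> `|x - c| <= r.
Proof. by rewrite /cball/= in_itv/= ler_distl. Qed.

Lemma measurable_cball c r : measurable (cball c r).
Proof. exact: measurable_itv. Qed.

Lemma lebesgue_measure_cball c r : 0 <= r -> mu (cball c r) = (r *+ 2)%:E.
Proof.
move=> r0; rewrite lebesgue_measure_itv/= lte_fin.
have [|h] := ltP (c - r) (c + r).
  by rewrite -EFinB => _; congr EFin; ring.
by have -> : r = 0 by [lra]; rewrite mul0rn.
Qed.

Lemma normc_ge_Im x z : `|complex.Im z| <= Normc.normc (x%:C%C - z).
Proof.
by case: z => a b /=; rewrite -sqrtr_sqr ler_sqrt ?addr_ge0 ?sqr_ge0// sub0r sqrrN lerDr sqr_ge0.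
Qed.

Lemma normc_ge_Re x z : `|x - complex.Re z| <= Normc.normc (x%:C%C - z).
Proof.
by case: z => a b /=; rewrite -sqrtr_sqr ler_sqrt ?addr_ge0 ?sqr_ge0// lerDl sqr_ge0.
Qed.

Lemma poisson_like_le r z x a : 0 <= r -> 0 < complex.Im z -> 0 < a ->
  a * complex.Im z <= Normc.normc (x%:C%C - z) ->
  poisson_like r z x <= a `^ (- r) / complex.Im z.
Proof.
move=> r0 y0 a0; rewrite /poisson_like.
set y := complex.Im z => le_a.
rewrite (@le_trans _ _ (y `^ (r - 1) / (a * y) `^ r))//.
  rewrite ler_pM2l ?powR_gt0// lef_pV2 ?posrE ?powR_gt0 ?mulr_gt0//; last first.
    by rewrite (lt_le_trans _ le_a)// mulr_gt0.
  by rewrite ge0_ler_powR// nnegrE ?(le_trans _ le_a)// ltW// mulr_gt0.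
rewrite powRM ?(ltW a0) ?(ltW y0)// powRN.
have -> : y `^ (r - 1) = y `^ r / y.
  by rewrite powRB ?powRr1 ?(ltW y0)// (gt_eqF y0) implybT.
by rewrite le_eqVlt; apply/orP; left; apply/eqP; field; rewrite !gt_eqF ?powR_gt0.
Qed.

Lemma poisson_like_ge0 r z x : 0 <= poisson_like r z x.
Proof. by rewrite divr_ge0 ?powR_ge0. Qed.

Lemma sum_geometric_le (t : R) n : 0 <= t -> t < 1 ->
  \sum_(0 <= k < n) t ^+ k <= (1 - t)^-1.
Proof.
move=> t0 t1; rewrite big_mkord -[leRHS]mul1r ler_pdivlMr ?subr_gt0//.
have /eqP := subrX1 t n; rewrite -subr_eq0 => /eqP h.
have := exprn_ge0 n t0; lra.
Qed.

(* The kernel is dominated by a series of multiples of indicators of the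
   intervals of radius [5 ^ k * Im z] around [Re z]. *)
Lemma integral_poisson_like_le r z (g : R -> R) (A t : R) :
  1 < r -> 0 < complex.Im z -> 0 <= A -> 0 <= t -> t * 5 `^ (1 - r) < 1 ->
  measurable_fun setT g -> (forall x, 0 <= g x) ->
  (forall k, \int[mu]_(x in cball (complex.Re z) (5 ^+ k * complex.Im z)) (g x)%:E
     <= (A * (5 ^+ k * complex.Im z) * t ^+ k)%:E)%E ->
  (\int[mu]_x (poisson_like r z x * g x)%:E <=
    (5 `^ r * A / (1 - t * 5 `^ (1 - r)))%:E)%E.
Proof.
move=> r1 y0 A0 t0 t1 mg g0 gA; have r0 : 0 <= r by lra.
pose B k := cball (complex.Re z) (5 ^+ k * complex.Im z).
(* For [k > 0], points of [B k] off [B (k - 1)] are at distance at least [5 ^ (k - 1) * Im z] from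
   [z], which bounds the kernel by [c k]. For [k = 0] the distance is at least [Im z]. *)
pose c k : R := 5 `^ r * (5 `^ (- r)) ^+ k / complex.Im z.
have c0 k : 0 <= c k.
  by rewrite /c divr_ge0 ?(ltW y0)// mulr_ge0 ?powR_ge0// exprn_ge0 ?powR_ge0.
pose G k x := ((c k)%:E * (g x * \1_(B k) x)%:E)%E.
have G0 k x : (0 <= G k x)%E by rewrite /G mule_ge0 ?lee_fin// mulr_ge0.
have mgB k : measurable_fun setT (fun x => (g x * \1_(B k) x)%:E).
  apply/measurable_EFinP; apply: measurable_funM => //.
  by apply: measurable_indic; exact: measurable_cball.
have mG k : measurable_fun setT (G k) by exact: measurable_funeM.
apply: (@le_trans _ _ (\int[mu]_x \sum_(k <oo) G k x)%E).
  apply: ge0_le_integralT => x; first by rewrite lee_fin mulr_ge0 ?poisson_like_ge0.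
  have exB : exists k, asbool (B k x).
    have [k hk] : exists k, `|x - complex.Re z| / complex.Im z <= 5 ^+ k.
      exists (Num.truncn (`|x - complex.Re z| / complex.Im z)).+1.
      rewrite (le_trans (ltW (truncnS_gt _)))//.
      by rewrite -natrX ler_nat ltnW// ltn_expl.
    by exists k; apply/asboolP/cballP; rewrite -ler_pdivrMr.
  (* For the least [k] with [x] in [B k], the single term [G k x] already dominates. *)
  case: (ex_minnP exB) => k /asboolP Bk kmin.
  apply: le_trans (nneseries_lim_ge k.+1 _); last by [].
  rewrite big_nat_recr//= (@le_trans _ _ (G k x))//; last first.
    by rewrite leeDr// sume_ge0.
  rewrite /G -EFinM lee_fin indicE mem_set// mulr1 ler_wpM2r//.
  case: k Bk kmin => [|k] Bk kmin.
    rewrite /c expr0 mulr1 (le_trans (@poisson_like_le r z x 1 _ _ _ _))//.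
      by rewrite mul1r (le_trans _ (normc_ge_Im x z))// ler_norm.
    by rewrite ler_pM2r ?invr_gt0// powR1 -[leLHS](powRr0 5) ler_powR//; lra.
  have far : 5 ^+ k * complex.Im z <= Normc.normc (x%:C%C - z).
    rewrite (le_trans _ (normc_ge_Re x z))// leNgt; apply/negP => /ltW h.
    have /kmin : asbool (B k x) by apply/asboolP/cballP.
    by rewrite ltnn.
  rewrite (le_trans (poisson_like_le r0 y0 _ far)) ?exprn_gt0//.
  rewrite ler_pM2r ?invr_gt0// /c exprS mulrA -powRD; last by rewrite pnatr_eq0 implybT.
  by rewrite addrN powRr0 mul1r powRX.
rewrite integral_nneseries//; apply: nneseries_le.
  by move=> k; exact: integral_ge0.
(* The ratio collects [5 ^ -r] from [c k], 5 from the radius and [t] from the growth of the averages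
   of [g]. *)
move=> n; apply: (@le_trans _ _
  (\sum_(0 <= k < n) (5 `^ r * A * (t * 5 `^ (1 - r)) ^+ k)%:E)%E).
  apply: lee_sum => k _; rewrite /G ge0_integralZl//; last 3 first.
  - exact: mgB.
  - by move=> x _; rewrite lee_fin mulr_ge0.
  - by rewrite lee_fin.
  have -> : (\int[mu]_x (g x * \1_(B k) x)%:E = \int[mu]_(x in B k) (g x)%:E)%E.
    by rewrite [RHS]integral_mkcond restrict_EFin; apply: eq_integral => x _; rewrite patch_indic.
  apply: (@le_trans _ _ ((c k)%:E * (A * (5 ^+ k * complex.Im z) * t ^+ k)%:E)%E).
    by apply: lee_wpmul2l; [rewrite lee_fin|exact: gA].
  rewrite -EFinM lee_fin /c powRD ?pnatr_eq0 ?implybT// powRr1// !exprMn.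
  rewrite le_eqVlt; apply/orP; left; apply/eqP; field.
  by rewrite gt_eqF.
rewrite sumEFin lee_fin -mulr_sumr ler_wpM2l ?mulr_ge0 ?powR_ge0//.
by apply: sum_geometric_le => //; rewrite mulr_ge0 ?powR_ge0.
Qed.

End kernel.

(** * The partition into levels and the nullity of the Cantor set *)

Section levels.
Context {R : realType}.
Local Notation mu := (@lebesgue_measure R).
Implicit Types (x : R) (m : int) (k i : nat).

(* Off the Cantor set, [x] lies in exactly one level; the exterior of
   [cantor_level 0] counts as level [0]. *)
Definition level k : set R :=
  (if k is 0 then setT else cantor_level k) `\` cantor_level k.+1.

Lemma level_sub k x : level k.+1 x -> cantor_level k.+1 x.
Proof. by case. Qed.

Lemma trivIset_level : trivIset setT level.
Proof.
have H i j x : (i < j)%N -> level i x -> ~ level j x.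
  case: j => // j ij [_ ix] /level_sub jx; apply: ix.
  exact: cantor_level_le jx.
by move=> i j _ _ [x [ix jx]]; have [/H|/H|//] := ltngtP i j => h; case: (h x).
Qed.

Lemma measurable_level k : measurable (level k).
Proof.
apply: measurableD; last exact: measurable_cyl.
by case: k => // k; exact: measurable_cyl.
Qed.

Lemma cantor_level_measure k : mu (cantor_level k) = ((2 / 5) ^+ k)%:E.
Proof.
rewrite (_ : cantor_level k = cell 0 0 `&` cantor_level k); last first.
  apply/seteqP; split => [x kx|x []//]; split => //.
  by move: (cantor_level_le (leq0n k) kx).
rewrite (@measure_cell_self_similar _ _ k (5 ^- k))//.
- by rewrite subn0 expr_div_n.
- exact: measurable_cyl.
- move=> m km; rewrite (_ : _ `&` _ = cell k m) ?lebesgue_measure_cell//.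
  apply/seteqP; split => [x []//|x xm]; split => //.
  by move: xm; rewrite /cell /cantor_level /cyl/= => /eqP ->.
Qed.

Lemma negligible_cantor : mu.-negligible (\bigcap_k (@cantor_level R k)).
Proof.
have mC : measurable (\bigcap_k (@cantor_level R k)).
  by apply: bigcapT_measurable => k; exact: measurable_cyl.
apply/negligibleP => //; apply/eqP; rewrite eq_le measure_ge0 andbT.
apply/lee_addgt0Pr => e e0; rewrite add0e.
have : (2 / 5 : R) ^+ k @[k --> \oo] --> (0 : R).
  by apply: cvg_expr; rewrite ger0_norm//; lra.
move=> /cvgrPdist_lt /(_ _ e0) [N _ /(_ N (leqnn N))] /=.
rewrite sub0r normrN ger0_norm ?exprn_ge0// => Ne.
apply: (@le_trans _ _ (mu (cantor_level N))).
  by apply: le_measure; rewrite ?inE//; [exact: measurable_cyl|exact: bigcap_inf].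
by rewrite cantor_level_measure lee_fin ltW.
Qed.

Lemma locally_integrable_le1 (g : R -> R) : measurable_fun setT g ->
  (forall x, 0 <= g x <= 1) -> locally_integrable setT g.
Proof.
move=> mg g01; split => //; first exact: openT.
move=> K _ cK; apply: (@le_lt_trans _ _ (\int[mu]_(x in K) 1%:E)%E).
  apply: ge0_le_integral => //.
  - exact: compact_measurable.
  - by apply/measurable_EFinP; apply: measurableT_comp => //; exact: measurable_funTS.
  - by move=> x _; have /andP[a b] := g01 x; rewrite lee_fin ger0_norm.
rewrite integral_cst ?mul1e; last exact: compact_measurable.
exact: compact_finite_measure.
Qed.

End levels.

(** * The two weights and the joint [A_p] bound *)

Section Ap_condition.
Context {R : realType} (p : R) (p1 : 1 < p).
Local Notation mu := (@lebesgue_measure R).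
Implicit Types (x y : R) (m : int) (n k i : nat) (z : R[i]).

(** On the Cantor set the value is the default 0; this set is null, so positivity a.e. is kept. *)
Definition target_weight : R -> R :=
  step level (fun k => ((2 / 5) ^+ k) `^ (p - 1)).
(** This is [v] recovered from [sigma = 1 + f]; the summand 1 makes [v] positive everywhere and at
    most 1. *)
Definition source_weight x : R := (1 + source p x) `^ (1 - p).

Lemma measurable_target_weight : measurable_fun setT target_weight.
Proof. exact: measurable_step measurable_level trivIset_level. Qed.

Lemma target_weight_ge0 x : 0 <= target_weight x.
Proof. by apply: step_ge0 => k; exact: powR_ge0. Qed.

Lemma pow25_le i k : (i <= k)%N -> ((2 / 5) ^+ k) `^ (p - 1) <= ((2 / 5) ^+ i) `^ (p - 1) :> R.
Proof.
move=> ik; rewrite ge0_ler_powR ?subr_ge0 ?(ltW p1)// ?nnegrE ?exprn_ge0//.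
by rewrite ler_wiXn2l//; lra.
Qed.

Lemma target_weight_le1 x : target_weight x <= 1.
Proof.
rewrite /target_weight; case: stepP => // k _.
by rewrite (le_trans (pow25_le (leq0n k)))// expr0 powR1.
Qed.

Lemma target_weight_le i x : cantor_level i x ->
  target_weight x <= ((2 / 5) ^+ i) `^ (p - 1).
Proof.
move=> xi; rewrite /target_weight; case: stepP => [k [_ kx]|_]; last exact: powR_ge0.
apply: pow25_le; rewrite leqNgt; apply/negP => ki; apply: kx.
exact: cantor_level_le xi.
Qed.

Lemma target_weight_gt0 x : ~ (\bigcap_k (@cantor_level R k)) x ->
  0 < target_weight x.
Proof.
move=> xC; rewrite /target_weight; case: stepP => [k _|xl].
  by rewrite powR_gt0// exprn_gt0//; lra.
(* A point in no level passes from each stage to the next, hence lies in all of them. *)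
case: xC => k _; case: k => [|k].
  by apply: cantor_levelS; apply: contrapT => h; apply: (xl 0%N).
elim: k => [|k IH]; first by apply: contrapT => h; apply: (xl 0%N).
by apply: contrapT => h; apply: (xl k.+1).
Qed.

Lemma weight_target : weight target_weight.
Proof.
split.
  apply: locally_integrable_le1 measurable_target_weight _ => x.
  by rewrite target_weight_ge0 target_weight_le1.
apply: negligibleS negligible_cantor => x /= h.
by apply: contrapT => /target_weight_gt0.
Qed.

Lemma measurable_source_weight : measurable_fun setT source_weight.
Proof.
apply: (measurableT_comp (measurable_powR _)).
by apply: measurable_funD => //; exact: measurable_source.
Qed.

Lemma weight_source : weight source_weight.
Proof.
have s1 x : 1 <= 1 + source p x by rewrite lerDl source_ge0.
split.
  apply: locally_integrable_le1 measurable_source_weight _ => x.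
  rewrite powR_ge0/= -[leRHS](powRr0 (1 + source p x)).
  by rewrite ler_powR// subr_le0 ltW.
by apply: aeW => x; rewrite powR_gt0// (lt_le_trans _ (s1 x)).
Qed.

Lemma source_weight_dual x :
  source_weight x `^ (- (p - 1)^-1) = 1 + source p x.
Proof.
rewrite /source_weight -powRrM (_ : _ * _ = 1) ?powRr1 ?addr_ge0 ?source_ge0//.
by field; rewrite subr_eq0 gt_eqF.
Qed.

(** * Averages of the weights around a point with critical scale [j] *)

Section at_point.
Variables (x0 y : R) (j : nat).
Hypothesis y0 : 0 < y.
Hypothesis j_in : j = 0%N \/ cantor_level j x0 /\ 5 ^+ j * y <= 1.
Hypothesis j_max : ~ (cantor_level j.+1 x0 /\ 5 ^+ j.+1 * y <= 1).

(** For [k < j] the ball lies in [E_(j - k - 1)] by [cantor_level_near], and the constant [c] is the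
    bound on the weight there. For [k >= j] one has [c >= 1], which bounds the weight everywhere.
    The leading 2 comes from the length of the ball. *)
Lemma integral_target_cball k :
  (\int[mu]_(x in cball x0 (5 ^+ k * y)) (target_weight x)%:E <=
   (2 * ((2 / 5) ^+ j * (5 / 2)) `^ (p - 1) * (5 ^+ k * y) *
     ((5 / 2) `^ (p - 1)) ^+ k)%:E)%E.
Proof.
clear j_max; have ky0 : 0 <= 5 ^+ k * y by rewrite mulr_ge0 ?exprn_ge0 ?(ltW y0).
set c := ((2 / 5) ^+ j * (5 / 2) * (5 / 2) ^+ k) `^ (p - 1).
have cE : c = ((2 / 5) ^+ j * (5 / 2)) `^ (p - 1) * ((5 / 2) `^ (p - 1)) ^+ k.
  have q0 : 0 <= 5 / 2 :> R by [].
  have a0 : 0 <= (2 / 5) ^+ j * (5 / 2) :> R by rewrite mulr_ge0 ?exprn_ge0.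
  by rewrite /c (powRM _ a0 (exprn_ge0 k q0)) (powRX _ _ q0).
have wc x : cball x0 (5 ^+ k * y) x -> target_weight x <= c.
  move=> /cballP xx0; have [jk|kj] := leqP j k.
    rewrite (le_trans (target_weight_le1 x))//.
    apply: (@le_trans _ _ (1 `^ (p - 1))); first by rewrite powR1.
    rewrite /c.
    rewrite ge0_ler_powR ?subr_ge0 ?(ltW p1) ?nnegrE ?mulr_ge0 ?exprn_ge0//.
    rewrite (@le_trans _ _ ((2 / 5) ^+ j * (5 / 2) ^+ j))//.
      by rewrite -exprMn (_ : 2 / 5 * (5 / 2) = 1) ?expr1n//; field.
    rewrite -mulrA ler_wpM2l ?exprn_ge0//.
    by rewrite -exprS ler_weXn2l ?leqW//; lra.
  have [j0|[jx jy]] := j_in; first by rewrite j0 in kj.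
  have xl : cantor_level (j - k).-1 x.
    apply: (@cantor_level_near _ _ _ x0).
      rewrite prednK ?subn_gt0// (le_trans _ jy)//.
      rewrite -{2}(subnK (ltnW kj)) exprD -mulrA ler_pM2l ?exprn_gt0//.
    rewrite prednK ?subn_gt0//; apply: cantor_level_le jx; exact: leq_subr.
  rewrite (le_trans (target_weight_le xl))//.
  rewrite ge0_ler_powR ?subr_ge0 ?(ltW p1) ?nnegrE ?mulr_ge0 ?exprn_ge0//.
  rewrite le_eqVlt; apply/orP; left; apply/eqP.
  rewrite (_ : j = (j - k).-1 + k.+1)%N; last by lia.
  rewrite (_ : ((j - k).-1 + k.+1 - k).-1 = (j - k).-1)%N; last by lia.
  have e1 : (2 / 5) ^+ k.+1 * ((5 / 2) * (5 / 2) ^+ k) = 1 :> R.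
    by rewrite -exprS -exprMn (_ : 2 / 5 * (5 / 2) = 1) ?expr1n//; field.
  by rewrite exprD -[in RHS]mulrA -[in RHS]mulrA e1 mulr1.
have h : (\int[mu]_(x in cball x0 (5 ^+ k * y)) (target_weight x)%:E <=
    \int[mu]_(x in cball x0 (5 ^+ k * y)) c%:E)%E.
  apply: ge0_le_integral => //.
  - exact: measurable_cball.
  - by move=> x _; rewrite lee_fin target_weight_ge0.
  - by apply/measurable_EFinP; exact: measurable_funTS measurable_target_weight.
apply: le_trans h _; rewrite integral_cst; last exact: measurable_cball.
rewrite [X in (_ * X)%E](lebesgue_measure_cball x0 ky0) -EFinM lee_fin cE.
by rewrite le_eqVlt; apply/orP; left; apply/eqP; rewrite -mulr_natl; ring.
Qed.

(** Choose [i] with [5 ^ i * r <= 1 < 5 ^ (i + 1) * r]. If [i <= j + 1], three cells of level [i]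
    cover the ball, each of mass at most [5 * 2 ^ -i], and [5 ^ -i <= 5 * r]; hence 75. If
    [i > j + 1], the point is off [E_(j + 1)], so the whole ball is off [E_(j + 2)] and [source_le]
    applies. *)
Lemma integral_source_small_cball r : y <= r -> r < 1 ->
  (\int[mu]_(x in cball x0 r) (source p x)%:E <= (75 * (5 / 2) ^+ j.+1 * r)%:E)%E.
Proof.
clear j_in => yr r1; have r0 : 0 < r by exact: lt_le_trans yr.
have ms := measurable_source p.
have msD D : measurable_fun D (fun x => (source p x)%:E).
  by apply/measurable_EFinP; exact: measurable_funTS ms.
have exi : exists i, 1 < 5 ^+ i.+1 * r.
  exists (Num.truncn r^-1); rewrite -ltr_pdivrMr// div1r.
  rewrite (lt_le_trans (truncnS_gt _))//.
  by rewrite -natrX ler_nat ltnW// ltn_expl.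
case: (ex_minnP exi) => i ir imin.
have ir1 : 5 ^+ i * r <= 1.
  case: i {ir} imin => [|i] imin; first by rewrite mul1r ltW.
  by rewrite leNgt; apply/negP => /imin; rewrite ltnn.
have [ij|ji] := leqP i j.+1.
  pose a := adic i x0.
  have sub : cball x0 r `<=` cell i (a - 1) `|` cell i a `|` cell i (a + 1).
    move=> x /cballP xx0; have : 5 ^+ i * `|x - x0| <= 1.
      by rewrite (le_trans _ ir1)// ler_pM2l// exprn_gt0.
    move=> /adic_near; rewrite -/a /cell /cyl/=.
    by move=> [->|[->|->]]; rewrite eqxx; [left;left|left;right|right].
  have m2 : measurable (cell i (a - 1) `|` cell i a : set R).
    by apply: measurableU; exact: measurable_cell.
  have m3 : measurable (cell i (a - 1) `|` cell i a `|` cell i (a + 1) : set R).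
    by apply: measurableU m2 _; exact: measurable_cell.
  have s0 x : (0 <= (source p x)%:E)%E by rewrite lee_fin source_ge0.
  apply: (@le_trans _ _ (\int[mu]_(x in cell i (a - 1) `|` cell i a `|`
      cell i (a + 1)) (source p x)%:E)%E).
    by apply: ge0_subset_integral => //; [exact: measurable_cball|exact: msD].
  rewrite ge0_integral_setU; last 5 first.
  - exact: m2.
  - exact: measurable_cell.
  - exact: msD.
  - by move=> ? _; exact: s0.
  - apply/disj_setPS => x [[]]; rewrite /cell /cyl/= => /eqP -> /eqP; clear; lia.
  rewrite ge0_integral_setU; last 5 first.
  - exact: measurable_cell.
  - exact: measurable_cell.
  - exact: msD.
  - by move=> ? _; exact: s0.
  - apply/disj_setPS => x []; rewrite /cell /cyl/= => /eqP -> /eqP; clear; lia.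
  apply: (@le_trans _ _ ((5 * 2 ^- i) + (5 * 2 ^- i) + (5 * 2 ^- i))%:E).
    by rewrite !EFinD !leeD// integral_source_cell.
  rewrite lee_fin.
  have -> : 2 ^- i = 5 ^- i * (5 / 2) ^+ i :> R.
    by rewrite expr_div_n; field; rewrite !expf_neq0.
  have h1 : 5 ^- i <= 5 * r.
    rewrite -[leLHS]mul1r ler_pdivrMr ?exprn_gt0//.
    by rewrite (le_trans (ltW ir))// exprS; lra.
  have h2 : (5 / 2) ^+ i <= (5 / 2) ^+ j.+1 :> R by rewrite ler_weXn2l//; lra.
  have h3 : 5 ^- i * (5 / 2) ^+ i <= 5 * r * (5 / 2) ^+ j.+1.
    by rewrite ler_pM// ?invr_ge0 ?exprn_ge0.
  lra.
(* Here [5 ^ (j + 1) * y <= 5 ^ i * r <= 1], so [j_max] excludes membership in [E_(j + 1)]. *)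
have x0N : ~ cantor_level j.+1 x0.
  move=> jx; apply: j_max; split => //.
  rewrite (le_trans _ ir1)// ler_pM// ?exprn_ge0// ?(ltW y0)//.
  by rewrite ler_weXn2l ?(ltnW ji)//; lra.
apply: (@le_trans _ _ (\int[mu]_(x in cball x0 r) (5 * (5 / 2) ^+ j.+2)%:E)%E).
  apply: ge0_le_integral => //.
  - exact: measurable_cball.
  - by move=> x _; rewrite lee_fin source_ge0.
  - exact: msD.
  - move=> x /cballP xx0; rewrite lee_fin source_le// => xj; apply: x0N.
    apply: cantor_level_near xj; rewrite distrC (le_trans _ ir1)//.
    rewrite ler_pM// ?exprn_ge0// ler_weXn2l//; lra.
rewrite integral_cst; last exact: measurable_cball.
rewrite [X in (_ * X)%E](lebesgue_measure_cball x0 (ltW r0)) -EFinM lee_fin.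
rewrite [in leLHS]exprS.
have : 0 <= (5 / 2) ^+ j.+1 * r by rewrite mulr_ge0 ?exprn_ge0// ltW.
lra.
Qed.

(** The constant is 75 plus 2, the summand 1 contributing the length [2 * r]. For [r >= 1] it
    suffices that the total mass of the source is at most 1. *)
Lemma integral_source_cball r : y <= r ->
  (\int[mu]_(x in cball x0 r) (1 + source p x)%:E <=
    (77 * (5 / 2) ^+ j.+1 * r)%:E)%E.
Proof.
move=> yr; have r0 : 0 < r by exact: lt_le_trans yr.
have ms := measurable_source p.
have msD D : measurable_fun D (fun x => (source p x)%:E).
  by apply/measurable_EFinP; exact: measurable_funTS ms.
have c1 : 1 <= (5 / 2) ^+ j.+1 :> R by rewrite exprn_ege1//; lra.
have h : (\int[mu]_(x in cball x0 r) (source p x)%:E <= (75 * (5 / 2) ^+ j.+1 * r)%:E)%E.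
  have [r1|r1] := ltP r 1; first exact: integral_source_small_cball.
  apply: (@le_trans _ _ (\int[mu]_x (source p x)%:E)%E).
    apply: ge0_subset_integral; [exact: measurable_cball|exact: measurableT|
      exact: msD|by move=> x _; rewrite lee_fin source_ge0|by []].
  rewrite (le_trans (integral_source p1))// lee_fin.
  have := mulr_ege1 c1 r1; lra.
rewrite [leLHS](_ : _ = (\int[mu]_(x in cball x0 r) (1%:E + (source p x)%:E))%E)//.
rewrite ge0_integralD; last 5 first.
- exact: measurable_cball.
- by [].
- by [].
- by move=> x _; rewrite lee_fin source_ge0.
- exact: msD.
rewrite integral_cst; last exact: measurable_cball.
rewrite [X in (_ * X + _)%E](lebesgue_measure_cball x0 (ltW r0)) mul1e.
apply: le_trans (leeD (lexx _) h) _.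
rewrite -EFinD lee_fin.
have : r <= (5 / 2) ^+ j.+1 * r by rewrite ler_peMl// ltW.
lra.
Qed.
End at_point.

(** Take the least [j] whose successor fails; one exists because [5 ^ j * y] is unbounded. If
    [j > 0], minimality says that the conditions hold at [j] itself. *)
Lemma exists_scale x0 y : 0 < y -> exists j : nat,
  (j = 0%N \/ cantor_level j x0 /\ 5 ^+ j * y <= 1) /\
  ~ (cantor_level j.+1 x0 /\ 5 ^+ j.+1 * y <= 1).
Proof.
move=> y0.
have exj : exists j, asbool (~ (cantor_level j.+1 x0 /\ 5 ^+ j.+1 * y <= 1)).
  exists (Num.truncn y^-1); apply/asboolP => -[_]; apply/negP; rewrite -ltNge.
  rewrite -ltr_pdivrMr// div1r (lt_le_trans (truncnS_gt _))//.
  by rewrite -natrX ler_nat ltnW// ltn_expl.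
case: (ex_minnP exj) => j /asboolP jN jmin; exists j; split => //.
case: j jN jmin => [|j] jN jmin; [by left|right].
by apply: contrapT => /asboolP/jmin; rewrite ltnn.
Qed.

Lemma joint_Ap_product_bounded q : p^-1 + q^-1 = 1 ->
  (ereal_sup [set joint_Ap_product p q target_weight source_weight z
             | z in @upper_half_plane R] < +oo)%E.
Proof.
move=> pq.
have p0 : 0 < p by exact: lt_trans ltr01 p1.
have q1 : 1 < q.
  have pi1 : p^-1 < 1 by rewrite invf_lt1.
  have pi0 : 0 < p^-1 by rewrite invr_gt0.
  have qi0 : 0 < q^-1 by lra.
  have q0 : 0 < q by rewrite -invr_gt0.
  rewrite -invf_lt1//; lra.
(* The geometric ratios for the kernel estimate: the averages of [w] grow by [(5 / 2) ^ (p - 1)] per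
   scale, so the ratio is [2 ^ (1 - p)]; those of [sigma] are bounded uniformly in the scale, so
   [t = 1]. *)
have tw : (5 / 2) `^ (p - 1) * 5 `^ (1 - p) < 1 :> R.
  rewrite -[1 - p]opprB powRN ltr_pdivrMr ?powR_gt0// mul1r.
  by rewrite gt0_ltr_powR ?nnegrE ?subr_gt0//; lra.
have ts : 1 * 5 `^ (1 - q) < 1 :> R.
  rewrite mul1r -[1 - q]opprB powRN invf_lt1 ?powR_gt0//.
  apply: (@le_lt_trans _ _ (1 `^ (q - 1))); first by rewrite powR1.
  by rewrite gt0_ltr_powR ?nnegrE ?subr_gt0//; lra.
pose Kw := 5 `^ p * 2 / (1 - (5 / 2) `^ (p - 1) * 5 `^ (1 - p)) : R.
pose Ks := 5 `^ q * 77 / (1 - 1 * 5 `^ (1 - q)) : R.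
have Kw0 : 0 <= Kw by rewrite divr_ge0 ?subr_ge0 ?(ltW tw)// mulr_ge0 ?powR_ge0.
have Ks0 : 0 <= Ks by rewrite divr_ge0 ?subr_ge0 ?(ltW ts)// mulr_ge0 ?powR_ge0.
apply: (@le_lt_trans _ _ (Kw * Ks `^ (p - 1) * (25 / 4) `^ (p - 1))%:E); last exact: ltry.
apply: ge_ereal_sup => _ [z y0 <-]; rewrite /upper_half_plane/= in y0.
have [j [j_in j_max]] := exists_scale (complex.Re z) y0.
set a := ((2 / 5) ^+ j * (5 / 2)) `^ (p - 1).
set b := (5 / 2) ^+ j.+1 : R.
have b0 : 0 <= b by rewrite exprn_ge0.
have Hw : (\int[mu]_x (poisson_like p z x * target_weight x)%:E <= (Kw * a)%:E)%E.
  have := @integral_poisson_like_le R p z target_weight (2 * a)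
    ((5 / 2) `^ (p - 1)) p1 y0 _ _ tw measurable_target_weight
    target_weight_ge0 (integral_target_cball y0 j_in).
  rewrite (_ : 5 `^ p * (2 * a) / _ = Kw * a); first by apply; rewrite ?mulr_ge0 ?powR_ge0.
  by rewrite /Kw mulrA mulrAC.
have Hs : (\int[mu]_x (poisson_like q z x *
    source_weight x `^ (- (p - 1)^-1))%:E <= (Ks * b)%:E)%E.
  under eq_integral do rewrite source_weight_dual.
  have := @integral_poisson_like_le R q z (fun x => 1 + source p x) (77 * b)
    1 q1 y0 _ ler01 ts.
  rewrite (_ : 5 `^ q * (77 * b) / _ = Ks * b); last by rewrite /Ks mulrA mulrAC.
  apply; first by rewrite mulr_ge0.
  - by apply: measurable_funD => //; exact: measurable_source.
  - by move=> x; rewrite addr_ge0// source_ge0.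
  - move=> k; rewrite expr1n mulr1; apply: (integral_source_cball y0 j_max).
    by rewrite ler_peMl ?(ltW y0)// exprn_ege1// ler1n.
have int0 (g : R -> R) r : (forall x, 0 <= g x) ->
    (0 <= \int[mu]_x (poisson_like r z x * g x)%:E)%E.
  by move=> g0; apply: integral_ge0 => x _; rewrite lee_fin mulr_ge0 ?poisson_like_ge0.
rewrite /joint_Ap_product.
apply: (@le_trans _ _ ((Kw * a)%:E * (Ks * b)%:E `^ (p - 1))%E).
  apply: lee_pmul => //.
  - by apply: int0; exact: target_weight_ge0.
  - exact: poweR_ge0.
  - apply: gt0_ler_poweR => //; first by rewrite subr_ge0 ltW.
    + by rewrite in_itv/= leey andbT; apply: int0 => x; exact: powR_ge0.
    + by rewrite in_itv/= leey andbT lee_fin mulr_ge0.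
rewrite poweR_EFin -EFinM lee_fin (powRM _ Ks0 b0).
(* The dependence on [j] cancels between the two factors and leaves [(5 / 2) ^ 2]. *)
rewrite (_ : 25 / 4 = (2 / 5) ^+ j * (5 / 2) * b); last first.
  have e1 : (2 / 5) ^+ j * (5 / 2) ^+ j = 1 :> R.
    by rewrite -exprMn (_ : 2 / 5 * (5 / 2) = 1) ?expr1n//; field.
  transitivity (25 / 4 * ((2 / 5) ^+ j * (5 / 2) ^+ j) : R).
    by rewrite e1 mulr1.
  by rewrite /b exprS; move: (_ ^+ j) (_ ^+ j) => X Y; field.
have c0 : 0 <= (2 / 5) ^+ j * (5 / 2) :> R by rewrite mulr_ge0 ?exprn_ge0.
by rewrite (powRM _ c0 b0) -/a le_eqVlt; apply/orP; left; apply/eqP; ring.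
Qed.

End Ap_condition.

Lemma integrable_EFin_restrict d (T : measurableType d) (R : realType)
    (mu : {measure set T -> \bar R}) (D : set T) (f : T -> R) : measurable D ->
  mu.-integrable D (EFin \o f) -> mu.-integrable setT (EFin \o (f \_ D)).
Proof. by move=> mD; rewrite -restrict_EFin => /integrable_mkcond; exact. Qed.

(** * The principal value at points of local constancy *)

Section hilbert_transform.
Context {R : realType}.
Local Notation mu := (@lebesgue_measure R).
Implicit Types (x y : R) (f : R -> R).

(** Reflection preserves the lengths of half-open intervals, and these determine Lebesgue measure.
    The case [a = x + x] is the symmetry about [x]. *)
Lemma lebesgue_measure_reflection (a : R) (A : set R) : measurable A ->
  pushforward mu ((fun y => a - y) : _ -> measurableTypeR R) A = mu A.
Proof.
move=> mA.
have mphi : measurable_fun setT ((fun y => a - y) : measurableTypeR R -> measurableTypeR R).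
  by apply: measurable_funB.
apply/esym/lebesgue_measure_unique => //= _ [[b c]] _ <-.
rewrite /pushforward.
rewrite (_ : _ @^-1` _ = `[a - c, a - b[%classic).
  rewrite !lebesgue_measure_itv/= !lte_fin ltrD2l ltrN2.
  by case: ifP => // _; rewrite -!EFinB; congr EFin; ring.
by apply/seteqP; split => y /=; rewrite !in_itv/=; lra.
Qed.

Lemma away_itv x e : away x e = ~` cball x e.
Proof.
apply/seteqP; split => y; rewrite /away/=.
  by rewrite distrC => h /cballP; rewrite leNgt h.
by move=> h; rewrite ltNge distrC; apply/negP => /cballP.
Qed.

Lemma measurable_away x e : measurable (away x e).
Proof. by rewrite away_itv; apply: measurableC; exact: measurable_cball. Qed.

Lemma measurable_kernel x e : 0 <= e ->
  measurable_fun (away x e) (fun y => (x - y)^-1).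
Proof.
move=> e0; apply: open_continuous_measurable_fun.
  by rewrite away_itv; apply: closed_openC; exact: itv_closed.
move=> y; rewrite inE /away/= => xy; apply: cvgV.
  by rewrite -normr_gt0 (le_lt_trans e0).
by apply: cvgB; [exact: cvg_cst|exact: cvg_id].
Qed.

Lemma integrable_away f x e : 0 < e -> mu.-integrable setT (EFin \o f) ->
  mu.-integrable (away x e) (fun y => (f y / (x - y))%:E).
Proof.
move=> e0 intf.
have mf : measurable_fun setT f by apply/measurable_EFinP; exact: measurable_int intf.
have intA : mu.-integrable (away x e) (fun y => (e^-1)%:E * (EFin \o f) y)%E.
  apply: integrableZl; first exact: measurable_away.
  by apply: integrableS intf => //; exact: measurable_away.
apply: le_integrable intA; first exact: measurable_away.
  apply/measurable_EFinP; apply: measurable_funM; last exact: measurable_kernel (ltW e0).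
  exact: measurable_funTS.
move=> y; rewrite /away/= => xy; rewrite lee_fin !normrM mulrC.
rewrite ler_wpM2r// normfV gtr0_norm ?invr_gt0// lef_pV2 ?posrE//.
  exact: ltW.
exact: lt_trans xy.
Qed.

(** Reflection about [x] preserves the annulus and changes the sign of the integrand, so the
    integral equals its own opposite. *)
Lemma Rintegral_odd_annulus (c x e d : R) : 0 < e ->
  \int[mu]_(y in away x e `&` cball x d) (c / (x - y)) = 0.
Proof.
move=> e0; set A := _ `&` _.
have mA : measurable A.
  by apply: measurableI; [exact: measurable_away|exact: measurable_cball].
have intA : mu.-integrable A (EFin \o (fun y => c / (x - y))).
  apply: measurable_bounded_integrable => //.
  - apply: le_lt_trans (ltry ((Num.max 0 d) *+ 2)).
    rewrite -(@lebesgue_measure_cball _ x) ?le_max ?lexx//.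
    apply: le_measure; rewrite ?inE//; first exact: measurable_cball.
    by move=> y [_] /cballP h; apply/cballP; rewrite le_max h orbT.
  - apply: measurable_funM => //.
    exact: measurable_funS (measurable_away x e) (@subIsetl _ _ _)
      (measurable_kernel (ltW e0)).
  - exists (`|c| / e); split; first exact: num_real.
    move=> M hM y [xy _] /=; rewrite normrM normfV (le_trans _ (ltW hM))//.
    rewrite ler_wpM2l// lef_pV2 ?posrE//; first exact: ltW.
    exact: lt_trans xy.
rewrite Rintegral_mkcond; set g := _ \_ A.
have intg : mu.-integrable setT (EFin \o g).
  exact: integrable_EFin_restrict.
have gN y : g (x + x - y) = - g y.
  have AE : (x + x - y \in A) = (y \in A).
    apply/idP/idP; rewrite !inE /A away_itv; move=> [h1 /cballP h2]; split.
    - move=> /cballP h; apply: h1; apply/cballP.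
      by rewrite (_ : _ - x = - (y - x)) ?normrN//; ring.
    - by apply/cballP; rewrite (_ : _ - x = - (x + x - y - x)) ?normrN//; ring.
    - move=> /cballP h; apply: h1; apply/cballP.
      by rewrite (_ : _ - x = - (x + x - y - x)) ?normrN//; ring.
    - by apply/cballP; rewrite (_ : _ - x = - (y - x)) ?normrN//; ring.
  rewrite /g /patch AE; case: ifP => _; last by rewrite oppr0.
  by rewrite -mulrN -invrN; congr (_ / _); ring.
have : \int[mu]_y g y = \int[mu]_y (-1 * g y).
  rewrite /Rintegral; congr fine.
  have mphi : measurable_fun setT ((fun y => x + x - y) : measurableTypeR R -> measurableTypeR R).
    by apply: measurable_funB.
  transitivity (\int[pushforward mu
    ((fun y => x + x - y)%R : _ -> measurableTypeR R)]_y (g y)%:E)%E.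
    by apply: eq_measure_integral => /= B mB _; exact/esym/lebesgue_measure_reflection.
  rewrite integral_pushforward//.
  - by apply: eq_integral => y _ /=; rewrite gN mulN1r.
  - exact: measurable_int intg.
  - rewrite preimage_setT.
    rewrite (_ : _ \o _ = (fun y => (-1)%:E * (EFin \o g) y)%E).
      exact: integrableZl.
    by apply/funext => y /=; rewrite gN -EFinM mulN1r.
rewrite RintegralZl//; lra.
Qed.

(** The annulus between the radii [e] and [d] contributes nothing, by oddness. Truncations are thus
    stationary near 0, which makes the principal value exist. *)
Lemma hilbert_trunc_cst f x c d : mu.-integrable setT (EFin \o f) ->
  (forall y, `|x - y| <= d -> f y = c) ->
  forall e, 0 < e -> e <= d -> hilbert_trunc f x e = hilbert_trunc f x d.
Proof.
move=> intf fc e e0 ed; rewrite /hilbert_trunc.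
have split_away : away x e = away x d `|` (away x e `&` cball x d).
  rewrite [in RHS]away_itv; apply/seteqP; split => y.
    by move=> ye; have [|] := pselect (cball x d y); [right|left].
  move=> [h|[]//]; rewrite /away/= ltNge; apply/negP => xye; apply: h.
  by apply/cballP; rewrite distrC (le_trans xye).
have mA : measurable (away x e `&` cball x d).
  by apply: measurableI; [exact: measurable_away|exact: measurable_cball].
rewrite [in LHS]split_away Rintegral_setU//; last 3 first.
- exact: measurable_away.
- by rewrite -split_away; exact: integrable_away.
- by apply/disj_setPS => y; rewrite away_itv => -[h []].
rewrite [X in _ + X](_ : _ = 0) ?addr0//.
rewrite -[RHS](Rintegral_odd_annulus c x d e0); apply: eq_Rintegral => y.
rewrite inE => -[_ /cballP h]; rewrite fc// distrC//.
Qed.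

Lemma near_hilbert_trunc f x c d : 0 < d -> mu.-integrable setT (EFin \o f) ->
  (forall y, `|x - y| <= d -> f y = c) ->
  \forall e \near 0^'+, hilbert_trunc f x e = hilbert_trunc f x d.
Proof.
move=> d0 intf fc; near=> e; apply: hilbert_trunc_cst fc _ _ _ => //.
by near: e; exact: nbhs_right_le.
Unshelve. all: by end_near. Qed.

Lemma hilbertE f x c d : 0 < d -> mu.-integrable setT (EFin \o f) ->
  (forall y, `|x - y| <= d -> f y = c) ->
  hilbert f x = hilbert_trunc f x d.
Proof.
by move=> d0 intf fc; apply: lim_near_cst => //; exact: near_hilbert_trunc fc.
Qed.

Lemma locally_constant_hilbert_defined f x c d : 0 < d ->
  mu.-integrable setT (EFin \o f) ->
  (forall y, `|x - y| <= d -> f y = c) -> hilbert_defined f x.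
Proof.
move=> d0 intf fc; split; first by move=> e e0; exact: integrable_away.
apply: (is_cvg_near_cst (hilbert_trunc f x d)).
exact: near_hilbert_trunc fc.
Qed.

(** As [f] vanishes around the singularity, the principal value is an ordinary integral; two such
    values can then be subtracted under the integral sign. *)
Lemma integrable_hilbert_kernel f x d : 0 < d -> mu.-integrable setT (EFin \o f) ->
  (forall y, `|x - y| <= d -> f y = 0) ->
  mu.-integrable setT (EFin \o (fun y => f y / (x - y))) /\
  hilbert f x = \int[mu]_y (f y / (x - y)).
Proof.
move=> d0 intf f0.
have E : (fun y => f y / (x - y)) \_ (away x d) = (fun y => f y / (x - y)).
  apply/funext => y; rewrite /patch; case: ifPn => //.
  by rewrite notin_setE away_itv => /contrapT/cballP h; rewrite f0 ?mul0r// distrC.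
split; last by rewrite (hilbertE d0 intf f0) /hilbert_trunc Rintegral_mkcond E.
rewrite -E; apply: integrable_EFin_restrict; first exact: measurable_away.
exact: integrable_away.
Qed.

(* Since [1 / (x1 - y) - 1 / (x2 - y)] is positive off [[x1, x2]], the Hilbert
   transform decreases across an interval on which [f] vanishes. *)
Lemma hilbert_gap f (D : set R) x1 x2 d r : 0 < d -> 0 < r -> x1 <= x2 -> measurable D ->
  mu.-integrable setT (EFin \o f) -> (forall y, 0 <= f y) ->
  (forall y, `|x1 - y| <= d -> f y = 0) ->
  (forall y, `|x2 - y| <= d -> f y = 0) ->
  (forall y, x1 <= y <= x2 -> f y = 0) ->
  (forall y, D y -> `|x1 - y| <= r /\ `|x2 - y| <= r) ->
  (x2 - x1) / r ^+ 2 * \int[mu]_(y in D) f y <= hilbert f x1 - hilbert f x2.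
Proof.
move=> d0 r0 x12 mD intf f0 z1 z2 z12 Dr.
have [i1 ->] := integrable_hilbert_kernel d0 intf z1.
have [i2 ->] := integrable_hilbert_kernel d0 intf z2.
have intD : mu.-integrable D (EFin \o f) by apply: integrableS intf.
rewrite -RintegralZl// -RintegralB// Rintegral_mkcond.
apply: le_Rintegral => //.
- apply: integrable_EFin_restrict => //.
  have := @integrableZl _ _ _ mu _ mD ((x2 - x1) / r ^+ 2) _ intD.
  by apply: eq_integrable.
- have := integrableB measurableT i1 i2.
  by apply: eq_integrable.
move=> y _; have [fy|fy] := eqVneq (f y) 0.
  by rewrite /patch fy !mul0r mulr0 subrr if_same.
(* Since [f] vanishes near [x1] and [x2], no division by zero intervenes where [f y] is nonzero. *)
have [n1 n2] : x1 - y != 0 /\ x2 - y != 0.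
  by split; apply/eqP => h; move/eqP: fy; apply; [apply: z1|apply: z2];
    rewrite h normr0 ltW.
have pos : 0 < (x1 - y) * (x2 - y).
  have [yx1|x1y] := ltP y x1; first by rewrite mulr_gt0; lra.
  have [yx2|x2y] := leP y x2; first by rewrite z12 ?eqxx ?x1y// in fy.
  by rewrite -mulrNN mulr_gt0; lra.
have -> : f y / (x1 - y) - f y / (x2 - y) = (x2 - x1) / ((x1 - y) * (x2 - y)) * f y.
  by field; rewrite n1 n2.
rewrite /patch; case: ifPn => yD; last first.
  by rewrite mulr_ge0// divr_ge0 ?subr_ge0// ltW.
(* On [D] both factors of the denominator are at most [r] in absolute value. *)
rewrite ler_wpM2r// ler_wpM2l ?subr_ge0// lef_pV2 ?posrE ?exprn_gt0//.
rewrite -(gtr0_norm pos) normrM expr2 ler_pM//.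
  by have [] := Dr y (set_mem yD).
by have [] := Dr y (set_mem yD).
Qed.

End hilbert_transform.

(** * The Hilbert transform of the source and its infinite norm *)

Section counterexample.
Context {R : realType} (p : R) (p1 : 1 < p).
Local Notation mu := (@lebesgue_measure R).
Implicit Types (x y : R) (m : int) (n k i : nat).

Lemma adic_eq_le i k x y : (i <= k)%N -> adic k x = adic k y -> adic i x = adic i y.
Proof.
move=> /subnK <-; elim: (k - i)%N => // d IH.
by rewrite addSn => h; apply: IH; rewrite (adicS _ x) (adicS _ y) h.
Qed.

(** Gaps of level below [k] are decided by the digits up to place [k], and all other gaps lie in
    [E_k]; so a cell off [E_k] lies inside one gap or misses all of them. *)
Lemma source_cst k x y : ~ cantor_level k x -> adic k y = adic k x ->
  source p y = source p x.
Proof.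
move=> xk xy.
have H (a b : R) : ~ cantor_level k a -> adic k a = adic k b ->
    forall i, source_gap i a -> source_gap i b.
  move=> ak ab i; have [ik|ki] := ltnP i k.
    by rewrite /source_gap /cyl/= (adic_eq_le ik ab).
  by move=> /source_gap_sub /(cantor_level_le ki).
have yk : ~ cantor_level k y by rewrite /cantor_level /cyl/= xy.
rewrite /source; case: (stepP _ _ x) => [i ix|xo].
  by rewrite (stepE _ (@trivIset_source_gap R) (H _ _ xk (esym xy) _ ix)).
by rewrite step_out// => i iy; exact: (xo i (H _ _ yk xy _ iy)).
Qed.

(** Such a point is interior to a cell off some stage. Half the distance to the nearer endpoint
    keeps the closed neighbourhood inside the half-open cell. *)
Lemma source_locally_constant x : ~ (\bigcap_k (@cantor_level R k)) x ->
  (forall n m, 5 ^+ n * x <> m%:~R) ->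
  exists2 d, 0 < d & forall y, `|x - y| <= d -> source p y = source p x.
Proof.
move=> xC xN; have [k xk] : exists k, ~ cantor_level k x.
  by apply/existsNP => h; apply: xC => k _.
have p5 : (0 : R) < 5 ^+ k by rewrite exprn_gt0.
have /andP[m1 m2] := floor_itv (5 ^+ k * x).
set m := Num.floor _ in m1 m2.
have m1' : m%:~R < 5 ^+ k * x by rewrite lt_neqAle m1 andbT eq_sym; apply/eqP/xN.
pose e := Num.min (5 ^+ k * x - m%:~R) ((m + 1)%:~R - 5 ^+ k * x).
have e0 : 0 < e by rewrite lt_min !subr_gt0 m1' m2.
exists (e / 2 / 5 ^+ k); first by rewrite !divr_gt0.
move=> y; rewrite ler_pdivlMr// => xy; apply: (source_cst xk).
apply: floor_def.
have : `|5 ^+ k * x - 5 ^+ k * y| <= e / 2.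
  by rewrite -mulrBr normrM gtr0_norm// mulrC.
have ea : e <= 5 ^+ k * x - m%:~R by rewrite ge_min lexx.
have eb : e <= (m + 1)%:~R - 5 ^+ k * x by rewrite ge_min lexx orbT.
rewrite ler_norml -/(adic k x) -/m => /andP[h1 h2]; apply/andP; split; lra.
Qed.

(** The exceptional points are the cell endpoints, which are countable, and the null Cantor set. *)
Lemma hilbert_ae_defined_source : hilbert_ae_defined (source p).
Proof.
pose N := range (fun nm : nat * int => nm.2%:~R / 5 ^+ nm.1 : R).
have N0 : mu.-negligible N.
  have cN : countable N by apply: sub_countable (card_image_le _ _) _; exact: countableP.
  apply/negligibleP; first by apply: countable_measurable.
  exact: countable_lebesgue_measure0.
apply: negligibleS (negligibleU N0 (@negligible_cantor R)) => x /= xH.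
have [xN|xN] := pselect (N x); [by left|right].
apply: contrapT => xC; apply: xH.
have [|d d0 fd] := source_locally_constant xC.
  move=> n m nm; apply: xN; exists (n, m) => //=.
  by rewrite -nm mulrC mulKf// expf_neq0.
exact: locally_constant_hilbert_defined d0 (integrable_source p1) fd.
Qed.

Lemma source_gap_vanish k m y : good k m -> adic k.+1 y = (m * 5 + 2)%R ->
  source p y = 0.
Proof.
move=> km yk; rewrite /source step_out// => i iy.
have yS : ~ cantor_level k.+1 y.
  by rewrite /cantor_level /cyl/= yk !inE; lia.
have yE : cantor_level k y by rewrite /cantor_level /cyl/= adicS yk (_ : (_ %/ 5)%Z = m)//; lia.
have [ik|ki|ik] := ltngtP i k.
- exact: source_gapN ik iy yE.
- exact/yS/(cantor_level_le ki)/source_gap_sub.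
- by move: iy; rewrite ik /source_gap /cyl/= yk; lia.
Qed.

(** [hilbert_gap] is applied with [D] the whole cell, [r = 5 ^ -k] and [d = 5 ^ -(k + 2)]. In the
    central gap the outer subcells 0 and 4 leave room for [d], and subcell 2 keeps
    [x2 - x1 >= 5 ^ -(k + 2)]. The constant 50 is 25 times the 2 lost in [integral_source_good]. *)
Lemma hilbert_source_gap k m x1 x2 : good k m ->
  cell k.+2 ((m * 5 + 2) * 5 + 1) x1 -> cell k.+2 ((m * 5 + 2) * 5 + 3) x2 ->
  (5 / 2) ^+ k * remaining_mass p k / 50 <=
    hilbert (source p) x1 - hilbert (source p) x2.
Proof.
move=> km c1 c2.
have p5 n : (0 : R) < 5 ^+ n by rewrite exprn_gt0.
have x1k : adic k.+2 x1 = ((m * 5 + 2) * 5 + 1)%R by apply/eqP.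
have x2k : adic k.+2 x2 = ((m * 5 + 2) * 5 + 3)%R by apply/eqP.
have x12 : 5 ^- k.+2 <= x2 - x1.
  move: c1 c2; rewrite !cellE/= !in_itv/= => /andP[_ h1] /andP[h2 _].
  apply: le_trans (lerB h2 (ltW h1)).
  rewrite -mulrBl -[leLHS]mul1r ler_pM2r ?invr_gt0//.
  by rewrite -intrB (_ : _ - _ = 1)//; ring.
have near0 x : (m * 5 + 2) * 5 < adic k.+2 x < (m * 5 + 2) * 5 + 4 ->
    forall y, `|x - y| <= 5 ^- k.+2 -> source p y = 0.
  move=> xk y xy; apply: (source_gap_vanish km); rewrite adicS.
  have : 5 ^+ k.+2 * `|y - x| <= 1.
    by rewrite distrC mulrC -ler_pdivlMr// div1r.
  move=> /adic_near; lia.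
have I0 := integral_source_good p1 km.
have If : mu.-integrable (cell k m) (EFin \o source p).
  by apply: integrableS (integrable_source p1) => //; exact: measurable_cell.
have Ige : 2 ^- k * (remaining_mass p k / 2) <= \int[mu]_(y in cell k m) source p y.
  rewrite -lee_fin /Rintegral fineK; first by case/andP: I0.
  by apply: integrable_fin_num => //; exact: measurable_cell.
have x12' : x1 <= x2 by rewrite -subr_ge0 (le_trans _ x12)// invr_ge0 ltW.
apply: le_trans (@hilbert_gap _ (source p) (cell k m) x1 x2 (5 ^- k.+2) (5 ^- k)
  _ _ x12' (measurable_cell k m) (integrable_source p1) (source_ge0 p1) _ _ _ _);
  rewrite ?invr_gt0//; last 4 first.
- by apply: near0; rewrite x1k; clear; lia.
- by apply: near0; rewrite x2k; clear; lia.
- move=> y /andP[h1 h2]; apply: (source_gap_vanish km); rewrite adicS.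
  have a1 : adic k.+2 x1 <= adic k.+2 y.
    exact: le_floor (ler_wpM2l (ltW (p5 k.+2)) h1).
  have a2 : adic k.+2 y <= adic k.+2 x2.
    exact: le_floor (ler_wpM2l (ltW (p5 k.+2)) h2).
  by move: a1 a2; rewrite x1k x2k; clear; lia.
- have H x y : adic k x = m -> cell k m y -> `|x - y| <= 5 ^- k.
    move=> xk; have : cell k m x by rewrite /cell /cyl/= xk.
    rewrite cellE/= !in_itv/= => /andP[a1 a2] /andP[b1 b2].
    have e1 : (m + 1)%:~R / 5 ^+ k = m%:~R / 5 ^+ k + 5 ^- k :> R.
      by rewrite intrD mulrDl mul1r.
    by rewrite ler_norml; apply/andP; split; lra.
  move=> y yk; split; apply: H yk; rewrite (adicS k) (adicS k.+1).
    by rewrite x1k; clear; lia.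
  by rewrite x2k; clear; lia.
have s1 : 5 ^+ k / 25 <= (x2 - x1) / (5 ^- k) ^+ 2.
  rewrite ler_pdivlMr ?exprn_gt0 ?invr_gt0//; apply: le_trans x12.
  rewrite le_eqVlt; apply/orP; left; apply/eqP; rewrite !exprS; field.
  by rewrite expf_neq0.
apply: le_trans (ler_pM _ _ s1 Ige); rewrite ?divr_ge0 ?(ltW (p5 _))//; last first.
  by rewrite mulr_ge0 ?invr_ge0 ?exprn_ge0// divr_ge0// powR_ge0.
rewrite expr_div_n le_eqVlt; apply/orP; left; apply/eqP; field.
by rewrite expf_neq0.
Qed.

(** Half of the drop found in [hilbert_source_gap]. *)
Definition receiver_height k : R := (5 / 2) ^+ k * remaining_mass p k / 100.

(** If [|Hf|] is below half of the drop at one point of subcell 1, it is at least that half on all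
    of subcell 3. With [good k m] under the existential, a side can be chosen for every [m]. *)
Lemma gap_side k m : exists b : bool, good k m -> forall x,
  cell k.+2 ((m * 5 + 2) * 5 + (if b then 1 else 3)) x ->
  receiver_height k <= `|hilbert (source p) x|.
Proof.
have [km|km] := boolP (good k m); last by exists true.
have [[x1 c1 h1]|h] := pselect (exists2 x1, cell k.+2 ((m * 5 + 2) * 5 + 1) x1 &
    `|hilbert (source p) x1| < receiver_height k).
  exists false => _ x2 c2; have := hilbert_source_gap km c1 c2.
  rewrite /receiver_height in h1 *; move: h1; rewrite ltr_norml => /andP[h1 h2] h3.
  by rewrite ler_normr; apply/orP; right; lra.
exists true => _ x1 c1; rewrite leNgt; apply/negP => x1h.
by apply: h; exists x1.
Qed.

Definition side k m : bool := projT1 (cid (gap_side k m)).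

Lemma sideP k m : good k m -> forall x,
  cell k.+2 ((m * 5 + 2) * 5 + (if side k m then 1 else 3)) x ->
  receiver_height k <= `|hilbert (source p) x|.
Proof. exact: (projT2 (cid (gap_side k m))). Qed.

(** The residues [11 = 2 * 5 + 1] and [13 = 2 * 5 + 3] are the last two digits of the chosen
    subcell. As the side depends on the integer index only, the set is a union of cells, hence
    measurable. *)
Definition receiver k : set R := cyl k.+2 (fun m =>
  good k (m %/ 25)%Z && ((m %% 25)%Z == if side k (m %/ 25)%Z then 11 else 13)).

Lemma adicSS k x : adic k x = (adic k.+2 x %/ 25)%Z.
Proof. by rewrite (adicS k) (adicS k.+1); lia. Qed.

Lemma receiver_sub k : receiver k `<=` cantor_level k.
Proof.
by move=> x; rewrite /receiver /cantor_level /cyl/= (adicSS k) => /andP[].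
Qed.

Lemma receiver_gap k x : receiver k x -> ~ cantor_level k.+1 x.
Proof.
rewrite /receiver /cantor_level /cyl/= (adicS k.+1) => /andP[_ d] /andP[+ _].
by rewrite !inE; move: d; case: (side _ _); lia.
Qed.

Lemma receiver_level k : receiver k `<=` level k.
Proof.
move=> x kx; split; last exact: receiver_gap.
by case: k kx => // k; exact: receiver_sub.
Qed.

Lemma trivIset_receiver : trivIset setT receiver.
Proof.
move=> i j _ _ [x [/receiver_level ix /receiver_level jx]].
by apply: (@trivIset_level R i j) => //; exists x.
Qed.

Lemma receiverP k x : receiver k x -> receiver_height k <= `|hilbert (source p) x|.
Proof.
rewrite /receiver /cyl/= => /andP[gk d].
apply: (sideP gk); rewrite /cell /cyl/=.
by move: d; case: (side _ _); lia.
Qed.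

Lemma measure_receiver k : mu (receiver k) = (2 ^+ k * 5 ^- k.+2)%:E.
Proof.
rewrite (_ : receiver k = cell 0 0 `&` receiver k); last first.
  apply/seteqP; split => [x kx|x []//]; split => //.
  exact: cantor_level_le (leq0n k) (receiver_sub kx).
rewrite (@measure_cell_self_similar _ _ k (5 ^- k.+2)) ?subn0//.
- exact: measurable_cyl.
- exact: receiver_sub.
move=> m km; rewrite -(lebesgue_measure_cell k.+2 (m * 25 + if side k m then 11 else 13)).
congr (mu _); apply/seteqP; split => x; rewrite /cell /receiver /cyl/= (adicSS k).
  move=> [/eqP xm /andP[_]]; rewrite xm; lia.
move=> /eqP xm; have xm' : (adic k.+2 x %/ 25)%Z = m by move: xm; case: (side k m); lia.
by rewrite xm' eqxx km; split => //; move: xm; case: (side k m); lia.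
Qed.

Lemma nneseries_harmonic (c : R) : 0 < c ->
  (\sum_(k <oo) (c * harmonic k)%:E = +oo)%E.
Proof.
move=> c0; apply/eqyP => A A0.
have nd : nondecreasing_seq (series (@harmonic R)).
  by apply/nondecreasing_series => k _ _; exact: harmonic_ge0.
have /cvgryPge/(_ (A / c)) [n _ /(_ n (leqnn n)) /= hn] :=
  nondecreasing_dvgn_lt nd (@dvg_harmonic R).
apply: le_trans (nneseries_lim_ge n _).
  by rewrite sumEFin lee_fin -mulr_sumr mulrC -ler_pdivrMr.
by move=> k _; rewrite lee_fin mulr_ge0 ?(ltW c0) ?harmonic_ge0.
Qed.

Lemma weighted_norm_hilbert_source :
  weighted_norm p (target_weight p) (hilbert (source p)) = +oo%E.
Proof.
have p0 : 0 < p by exact: lt_trans ltr01 p1.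
rewrite /weighted_norm (_ : integral _ _ _ = +oo%E).
  by rewrite poweRyr// invr_eq0 gt_eqF.
apply/eqP; rewrite -leye_eq.
(* A lower bound of [|Hf| ^ p * w] on [receiver k], which lies in [level k]. *)
pose c k : R := receiver_height k `^ p * ((2 / 5) ^+ k) `^ (p - 1).
have hk0 k : 0 <= receiver_height k.
  by rewrite divr_ge0// mulr_ge0 ?exprn_ge0 ?powR_ge0.
have c0 k : 0 <= c k by rewrite mulr_ge0 ?powR_ge0.
apply: (@le_trans _ _ (\int[mu]_x (step receiver c x)%:E)%E); last first.
  apply: ge0_le_integralT => x; first by rewrite lee_fin step_ge0.
  rewrite lee_fin; case: stepP => [k kx|_]; last by rewrite mulr_ge0 ?powR_ge0 ?target_weight_ge0.
  rewrite /target_weight (stepE _ (@trivIset_level R) (receiver_level kx)).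
  rewrite ler_wpM2r ?powR_ge0// ge0_ler_powR ?nnegrE ?(ltW p0)//.
  exact: receiverP.
rewrite integral_step//; last 2 first.
- by move=> k; exact: measurable_cyl.
- exact: trivIset_receiver.
(* Each term of the series is [1 / (100 ^ p * 25 * (k + 1))]: [M_k ^ p] is [1 / (k + 1)], the powers
   of [s] reduce to [s] and cancel the measure [(2 / 5) ^ k] of [E_k], and 25 is the inverse
   proportion of a subcell. *)
have a0 : 0 < (100 `^ p * 25)^-1 :> R by rewrite invr_gt0 mulr_gt0 ?powR_gt0.
rewrite -(nneseries_harmonic a0) le_eqVlt; apply/orP; left; apply/eqP.
apply: eq_eseriesr => k _; rewrite setTI [X in (_ * X)%E](measure_receiver k) -EFinM.
congr EFin; apply: esym; rewrite /c /receiver_height /harmonic /=.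
have Mp : remaining_mass p k `^ p = k.+1%:R^-1.
  by rewrite /remaining_mass -powRrM mulNr mulVf ?gt_eqF// powR_inv1.
set s := (5 / 2) ^+ k : R.
have s0 : 0 < s by rewrite exprn_gt0//; lra.
have sV : (2 / 5) ^+ k = s^-1 :> R by rewrite -exprVn invf_div.
have sP : s `^ p * s^-1 `^ (p - 1) = s.
  rewrite -(powR_inv1 (ltW s0)) -powRrM -powRD ?(gt_eqF s0) ?implybT//.
  by rewrite (_ : p + _ = 1) ?powRr1 ?(ltW s0)//; ring.
have hP : 100^-1 `^ p = (100 `^ p)^-1 :> R by rewrite -powRN -powR_inv1// -powRrM mulN1r.
rewrite sV !powRM ?mulr_ge0 ?powR_ge0 ?(ltW s0)// Mp hP.
transitivity (s `^ p * s^-1 `^ (p - 1) * k.+1%:R^-1 / 100 `^ p * (2 ^+ k / 5 ^+ k.+2)).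
  by ring.
rewrite sP.
rewrite /s expr_div_n !exprS; field.
by rewrite nat1r pnatr_eq0 !expf_neq0 ?gt_eqF ?powR_gt0.
Qed.

(** Since [f <= 1 + f], the integrand [f ^ p * (1 + f) ^ (1 - p)] is at most [f], whose integral is
    at most 1. *)
Lemma in_weighted_Lp_source : in_weighted_Lp p (source_weight p) (source p).
Proof.
have p0 : 0 < p by exact: lt_trans ltr01 p1.
split; first exact: measurable_source.
apply: poweR_lty; apply: le_lt_trans (ltry 1); apply: le_trans (integral_source p1).
apply: ge0_le_integralT => x; rewrite lee_fin.
  by rewrite mulr_ge0 ?powR_ge0.
have f0 := source_ge0 p1 x; rewrite /source_weight; set f := source p x in f0 *.
rewrite ger0_norm//; have [->|fN] := eqVneq f 0.
  by rewrite powR0 ?mul0r// gt_eqF.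
have fp : 0 < f by rewrite lt_neqAle eq_sym fN.
have -> : f `^ p = f * f `^ (p - 1).
  by rewrite -{2}[f]powRr1// -powRD ?fN ?implybT//; congr (_ `^ _); ring.
rewrite -mulrA ler_piMr// -[1 - p]opprB powRN.
rewrite ler_pdivrMr ?mul1r; last by apply: powR_gt0; lra.
by apply: ge0_ler_powR; rewrite ?nnegrE ?subr_ge0 ?(ltW p1)//; lra.
Qed.

End counterexample.

Unset Implicit Arguments.

Theorem theorem1p3 (R : realType) (p q : R) (p1 : 1 < p)
    (pq : p^-1 + q^-1 = 1) :
  exists w v : R -> R,
    [/\ weight w, weight v,
        (ereal_sup [set joint_Ap_product p q w v z | z in upper_half_plane]
           < +oo)%E,
        ~ hilbert_bounded p v w
      & exists f : R -> R,
          [/\ in_weighted_Lp p v f, hilbert_ae_defined f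
            & weighted_norm p w (hilbert f) = +oo%E]].
Proof.
exists (target_weight p), (source_weight p).
have inLp := in_weighted_Lp_source p1.
have aeH := hilbert_ae_defined_source p1.
have Hoo := weighted_norm_hilbert_source p1.
split.
- exact: weight_target.
- exact: weight_source.
- exact: joint_Ap_product_bounded.
- move=> [C /(_ _ inLp aeH)]; rewrite Hoo leye_eq => /eqP h.
  have : (C%:E * weighted_norm p (source_weight p) (source p))%E \is a fin_num.
    apply: fin_numM => //; rewrite ge0_fin_numE; first by case: inLp.
    exact: poweR_ge0.
  by rewrite h.
- by exists (source p).
Qed.
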